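(* For every set of generators (of any cardinality) and every $n<\omega$, the free GLP-algebra on that set of generators enjoys the $\langle n\rangle$-reduction property: for every element $x$ of it and every $z$, if $\langle n+1\rangle x\le\langle n\rangle z$ then there exists $k<\omega$ with $Q_n^k(x)\le\langle n\rangle z$.
   Context: A GLP-algebra is a boolean algebra ${\mathcal M}$ with unary operations $\langle n\rangle$, $n<\omega$, satisfying for all $x,y$: (i) $\langle n\rangle(x\vee y)=\langle n\rangle x\vee\langle n\rangle y$; (ii) $\langle n\rangle 0=0$; (iii) $\langle n\rangle x=\langle n\rangle(x\wedge\neg\langle n\rangle x)$; (iv) $\langle n\rangle x\le\langle m\rangle x$ for $m\le n$; (v) $\langle m\rangle x\le[n]\langle m\rangle x$ for $m<n$, where $[n]x:=\neg\langle n\rangle\neg x$. Define $Q_n^0(x)=\top$, $Q_n^{k+1}(x)=\langle n\rangle(x\wedge Q_n^k(x))$. The $\langle n\rangle$-reduction property for ${\mathcal M}$ is: for all $x\in{\mathcal M}$, $\{Q_n^k(x):k<\omega\}\vdash_n\langle n+1\rangle x$, where $A\vdash_n B$ means that for all $z\in{\mathcal M}$, if some finite meet of elements of $B$ is $\le\langle n\rangle z$ then some finite meet of elements of $A$ is $\le\langle n\rangle z$ (since the $Q_n^k(x)$ decrease in $k$, this amounts to the formulation in the claim). *)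

(* Defs.v *)
(* The free GLP-algebra on a set V of generators is built as in
   universal algebra: the term algebra over V modulo the least congruence
   containing the axioms of boolean algebras and the GLP axioms (i)-(v). *)
From Stdlib Require Import Arith.

Set Implicit Arguments.

Inductive term (V : Type) : Type :=
| tvar : V -> term V
| tbot : term V
| ttop : term V
| tneg : term V -> term V
| tjoin : term V -> term V -> term V
| tmeet : term V -> term V -> term V
| tdia : nat -> term V -> term V.

Arguments tbot {V}.
Arguments ttop {V}.

Definition tbox (V : Type) (n : nat) (x : term V) : term V :=
  tneg (tdia n (tneg x)).

(* Least congruence on terms containing the boolean algebra axioms
   (bounded distributive complemented lattice) and GLP axioms (i)-(v),
   where a <= b is encoded as  a /\ b = a . *)
Inductive teq (V : Type) : term V -> term V -> Prop :=
| teq_refl : forall x, teq x x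
| teq_sym : forall x y, teq x y -> teq y x
| teq_trans : forall x y z, teq x y -> teq y z -> teq x z
| teq_neg : forall x x', teq x x' -> teq (tneg x) (tneg x')
| teq_join : forall x x' y y', teq x x' -> teq y y' -> teq (tjoin x y) (tjoin x' y')
| teq_meet : forall x x' y y', teq x x' -> teq y y' -> teq (tmeet x y) (tmeet x' y')
| teq_dia : forall n x x', teq x x' -> teq (tdia n x) (tdia n x')
| ba_join_assoc : forall x y z, teq (tjoin x (tjoin y z)) (tjoin (tjoin x y) z)
| ba_meet_assoc : forall x y z, teq (tmeet x (tmeet y z)) (tmeet (tmeet x y) z)
| ba_join_comm : forall x y, teq (tjoin x y) (tjoin y x)
| ba_meet_comm : forall x y, teq (tmeet x y) (tmeet y x)
| ba_join_absorb : forall x y, teq (tjoin x (tmeet x y)) x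
| ba_meet_absorb : forall x y, teq (tmeet x (tjoin x y)) x
| ba_distr : forall x y z, teq (tmeet x (tjoin y z)) (tjoin (tmeet x y) (tmeet x z))
| ba_join_bot : forall x, teq (tjoin x tbot) x
| ba_meet_top : forall x, teq (tmeet x ttop) x
| ba_compl_join : forall x, teq (tjoin x (tneg x)) ttop
| ba_compl_meet : forall x, teq (tmeet x (tneg x)) tbot
| glp_i : forall n x y, teq (tdia n (tjoin x y)) (tjoin (tdia n x) (tdia n y))
| glp_ii : forall n, teq (tdia n tbot) tbot
| glp_iii : forall n x, teq (tdia n x) (tdia n (tmeet x (tneg (tdia n x))))
| glp_iv : forall m n x, m <= n -> teq (tmeet (tdia n x) (tdia m x)) (tdia n x)
| glp_v : forall m n x, m < n ->
    teq (tmeet (tdia m x) (tbox n (tdia m x))) (tdia m x).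

Definition fle (V : Type) (x y : term V) : Prop := teq (tmeet x y) x.

Fixpoint Q (V : Type) (n k : nat) (x : term V) : term V :=
  match k with
  | 0 => ttop
  | S k' => tdia n (tmeet x (Q n k' x))
  end.

(* Main.v *)
(* Let [refl n a] be the term a -> <n>a. Extend the free algebra M by one new
   point whose propositions take values in M modulo the filter generated by the
   reflection terms [refl n a], and where <k>a holds iff
     <k>a          (k <= n),
     a \/ <n+1>a   (k = n+1),
     false         (k > n+1)
   holds in M. The GLP axioms remain valid at this point; reflection is needed
   only for <n+1>a <= <m>a with m <= n. Hence <n+1>x <= <n>z in the free algebra
   yields finitely many reflection terms whose meet with x is below <n>z. Finally,
   a fixed reflection term fails at most once along an <n>-chain, so Q_n^{k+1}(x)
   provides an <n>-successor satisfying x and k given reflection terms. *)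
Require Import Defs.
From Stdlib Require Import Arith Lia List Setoid Morphisms.
Import ListNotations.

Set Implicit Arguments.

#[local] Instance teq_equivalence V : Equivalence (@teq V).
Proof. split; [exact (@teq_refl V) | exact (@teq_sym V) | exact (@teq_trans V)]. Qed.

#[local] Instance tneg_proper V : Proper (@teq V ==> @teq V) (@tneg V).
Proof. intros x x' Hx. now apply teq_neg. Qed.

#[local] Instance tjoin_proper V : Proper (@teq V ==> @teq V ==> @teq V) (@tjoin V).
Proof. intros x x' Hx y y' Hy. now apply teq_join. Qed.

#[local] Instance tmeet_proper V : Proper (@teq V ==> @teq V ==> @teq V) (@tmeet V).
Proof. intros x x' Hx y y' Hy. now apply teq_meet. Qed.

#[local] Instance tdia_proper V k : Proper (@teq V ==> @teq V) (@tdia V k).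
Proof. intros x x' Hx. now apply teq_dia. Qed.

#[local] Instance fle_proper V : Proper (@teq V ==> @teq V ==> iff) (@fle V).
Proof. intros x x' Hx y y' Hy. unfold fle. now rewrite Hx, Hy. Qed.

(** * Boolean algebra *)

Section Boolean.
Variable V : Type.
Implicit Types a b c d : term V.

Lemma meet_idem a : teq (tmeet a a) a.
Proof. rewrite <- (ba_join_absorb a a) at 2. apply ba_meet_absorb. Qed.

Lemma fle_refl a : fle a a.
Proof. apply meet_idem. Qed.

Lemma fle_trans b a c : fle a b -> fle b c -> fle a c.
Proof.
  unfold fle. intros Hab Hbc.
  now rewrite <- Hab, <- ba_meet_assoc, Hbc.
Qed.

Lemma fle_antisym a b : fle a b -> fle b a -> teq a b.
Proof. unfold fle. intros Hab Hba. now rewrite <- Hab, ba_meet_comm. Qed.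

Lemma meet_fle_r a b : fle (tmeet a b) b.
Proof. unfold fle. now rewrite <- ba_meet_assoc, meet_idem. Qed.

Lemma meet_fle_l a b : fle (tmeet a b) a.
Proof. rewrite ba_meet_comm. apply meet_fle_r. Qed.

Lemma fle_meet a b c : fle a b -> fle a c -> fle a (tmeet b c).
Proof. unfold fle. intros Hb Hc. now rewrite ba_meet_assoc, Hb. Qed.

Lemma fle_join_l a b : fle a (tjoin a b).
Proof. apply ba_meet_absorb. Qed.

Lemma fle_join_r a b : fle b (tjoin a b).
Proof. rewrite ba_join_comm. apply fle_join_l. Qed.

Lemma join_fle a b c : fle a c -> fle b c -> fle (tjoin a b) c.
Proof.
  unfold fle. intros Ha Hb.
  now rewrite ba_meet_comm, ba_distr, (ba_meet_comm c a), (ba_meet_comm c b), Ha, Hb.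
Qed.

Lemma fle_join_eq a b : fle a b -> teq (tjoin a b) b.
Proof.
  intros H. apply fle_antisym; [|apply fle_join_r].
  now apply join_fle; [|apply fle_refl].
Qed.

Lemma fle_top a : fle a ttop.
Proof. apply ba_meet_top. Qed.

Lemma bot_fle a : fle tbot a.
Proof. rewrite <- (ba_join_bot a), ba_join_comm. apply fle_join_l. Qed.

Lemma meet_mono a b c d : fle a b -> fle c d -> fle (tmeet a c) (tmeet b d).
Proof.
  intros Hab Hcd. apply fle_meet.
  - eapply fle_trans; [apply meet_fle_l|exact Hab].
  - eapply fle_trans; [apply meet_fle_r|exact Hcd].
Qed.

Lemma fle_cases b a c : fle (tmeet a b) c -> fle (tmeet a (tneg b)) c -> fle a c.
Proof.
  intros H1 H2. rewrite <- (ba_meet_top a), <- (ba_compl_join b), ba_distr.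
  now apply join_fle.
Qed.

Lemma fle_contra b a c : fle a b -> fle a (tneg b) -> fle a c.
Proof.
  intros H1 H2. apply fle_trans with (tmeet b (tneg b)).
  - now apply fle_meet.
  - rewrite ba_compl_meet. apply bot_fle.
Qed.

Lemma fle_neg a b : fle (tmeet a b) tbot -> fle a (tneg b).
Proof.
  intros H. apply fle_cases with b.
  - apply fle_trans with tbot; [exact H|apply bot_fle].
  - apply meet_fle_r.
Qed.

Lemma neg_anti a b : fle a b -> fle (tneg b) (tneg a).
Proof.
  intros H. apply fle_neg, fle_contra with b.
  - eapply fle_trans; [apply meet_fle_r|exact H].
  - apply meet_fle_l.
Qed.

Lemma neg_bot : teq (tneg (@tbot V)) ttop.
Proof. now rewrite <- (ba_join_bot (tneg tbot)), ba_join_comm, ba_compl_join. Qed.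

End Boolean.

(** * The modalities *)

Section Modal.
Variable V : Type.
Implicit Types a b x y z : term V.

Lemma dia_mono k a b : fle a b -> fle (tdia k a) (tdia k b).
Proof.
  intros H. rewrite <- (fle_join_eq H), glp_i. apply fle_join_l.
Qed.

(* Loeb's axiom applied to [a \/ <k>a]. *)
Lemma dia_trans k a : fle (tdia k (tdia k a)) (tdia k a).
Proof.
  set (y := tjoin a (tdia k a)).
  apply fle_trans with (tdia k y); [apply dia_mono, fle_join_r|].
  rewrite glp_iii. apply dia_mono.
  apply fle_cases with a; [apply meet_fle_r|].
  apply fle_contra with (tdia k a).
  - unfold y at 1. eapply fle_trans; [apply meet_mono; [apply meet_fle_l|apply fle_refl]|].
    rewrite ba_meet_comm, ba_distr. apply join_fle; [|apply meet_fle_r].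
    rewrite ba_meet_comm, ba_compl_meet. apply bot_fle.
  - eapply fle_trans; [apply meet_fle_l|].
    eapply fle_trans; [apply meet_fle_r|].
    apply neg_anti, dia_mono, fle_join_l.
Qed.

Lemma dia_meet_box k a b :
  fle (tmeet (tdia k a) (tneg (tdia k b))) (tdia k (tmeet a (tneg b))).
Proof.
  apply fle_trans with (tmeet (tjoin (tdia k b) (tdia k (tmeet a (tneg b))))
                              (tneg (tdia k b))).
  - apply meet_mono; [|apply fle_refl].
    rewrite <- glp_i. apply dia_mono. apply fle_cases with b.
    + eapply fle_trans; [apply meet_fle_r|apply fle_join_l].
    + apply fle_join_r.
  - rewrite ba_meet_comm, ba_distr. apply join_fle; [|apply meet_fle_r].
    rewrite ba_meet_comm, ba_compl_meet. apply bot_fle.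
Qed.

(** * Reflection terms along [<n>]-chains *)

Definition refl n a : term V := tjoin (tneg a) (tdia n a).

Lemma refl_elim n a : fle (tmeet (refl n a) a) (tdia n a).
Proof.
  unfold refl. rewrite ba_meet_comm, ba_distr, ba_compl_meet.
  apply join_fle; [apply bot_fle|apply meet_fle_r].
Qed.

Lemma neg_refl_fle n a : fle (tneg (refl n a)) (tneg (tdia n a)).
Proof. apply neg_anti, fle_join_r. Qed.

(** When [<n>a] fails, transitivity makes [a] fail all along the chain, and [refl n a] holds
    wherever [a] fails. *)
Lemma Q_refl_of_box n a x k :
  fle (tmeet (Q n k x) (tneg (tdia n a))) (Q n k (tmeet x (refl n a))).
Proof.
  induction k as [|k IH]; cbn [Q]; [apply fle_top|].
  (* Excluding [b] at the successor gives [tneg a], hence the reflection term, and also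
     [tneg (tdia n a)], under which [IH] applies again. *)
  set (b := tjoin a (tdia n a)).
  apply fle_trans with (tmeet (tdia n (tmeet x (Q n k x))) (tneg (tdia n b))).
  - apply meet_mono; [apply fle_refl|]. apply neg_anti.
    unfold b. rewrite glp_i. apply join_fle; [apply fle_refl|apply dia_trans].
  - eapply fle_trans; [apply dia_meet_box|]. apply dia_mono.
    set (w := tmeet (tmeet x (Q n k x)) (tneg b)).
    assert (Hx : fle w x) by (eapply fle_trans; apply meet_fle_l).
    assert (HQ : fle w (Q n k x))
      by (eapply fle_trans; [apply meet_fle_l|apply meet_fle_r]).
    assert (Hb : fle w (tneg b)) by apply meet_fle_r.
    repeat apply fle_meet.
    + exact Hx.
    + apply fle_trans with (tneg a); [|apply fle_join_l].
      apply fle_trans with (tneg b); [exact Hb|apply neg_anti, fle_join_l].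
    + eapply fle_trans; [|exact IH]. apply fle_meet; [exact HQ|].
      apply fle_trans with (tneg b); [exact Hb|apply neg_anti, fle_join_r].
Qed.

(* If [refl n a] fails at some point of an <n>-chain, then [a] fails at all
   later points, where [refl n a] therefore holds. *)
Lemma Q_succ_refl n a x k : fle (Q n (S k) x) (Q n k (tmeet x (refl n a))).
Proof.
  induction k as [|k IH]; [apply fle_top|].
  change (Q n (S (S k)) x) with (tdia n (tmeet x (Q n (S k) x))).
  (* [p] covers a successor that satisfies [refl n a]. At any other successor [Q_refl_of_box]
     supplies the whole chain of length [S k], and transitivity removes the extra step. *)
  set (p := tmeet (tmeet x (refl n a)) (Q n k (tmeet x (refl n a)))).
  apply fle_trans with (tdia n (tjoin p (Q n (S k) (tmeet x (refl n a))))).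
  - apply dia_mono, fle_cases with (refl n a).
    + eapply fle_trans; [|apply fle_join_l]. repeat apply fle_meet.
      * eapply fle_trans; apply meet_fle_l.
      * apply meet_fle_r.
      * eapply fle_trans; [apply meet_fle_l|].
        eapply fle_trans; [apply meet_fle_r|exact IH].
    + eapply fle_trans; [|apply fle_join_r].
      eapply fle_trans; [|apply Q_refl_of_box].
      apply meet_mono; [apply meet_fle_r|apply neg_refl_fle].
  - rewrite glp_i. apply join_fle; [apply fle_refl|apply dia_trans].
Qed.

Fixpoint refls n (l : list (term V)) : term V :=
  match l with
  | [] => ttop
  | a :: l' => tmeet (refl n a) (refls n l')
  end.

#[local] Instance Q_proper n k : Proper (@teq V ==> @teq V) (Q n k).
Proof.
  induction k as [|k IH]; intros x x' Hx; cbn [Q]; [reflexivity|].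
  now rewrite (IH _ _ Hx), Hx.
Qed.

(** Each reflection term is absorbed into [x] at the price of one step of the chain, so [x] must
    vary in the induction. *)
Lemma Q_add_refls n l : forall x k,
  fle (Q n (length l + k) x) (Q n k (tmeet x (refls n l))).
Proof.
  induction l as [|a l IH]; intros x k; cbn [length Nat.add refls].
  - rewrite ba_meet_top. apply fle_refl.
  - eapply fle_trans; [apply (Q_succ_refl n a)|].
    rewrite ba_meet_assoc. apply IH.
Qed.

Lemma refls_app_l n l l' : fle (refls n (l ++ l')) (refls n l).
Proof.
  induction l as [|a l IH]; cbn; [apply fle_top|].
  apply meet_mono; [apply fle_refl|exact IH].
Qed.

Lemma refls_app_r n l l' : fle (refls n (l ++ l')) (refls n l').
Proof.
  induction l as [|a l IH]; cbn; [apply fle_refl|].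
  eapply fle_trans; [apply meet_fle_r|exact IH].
Qed.

End Modal.

(** * The new point *)

Section NewPoint.
Variables (V : Type) (n : nat).
Implicit Types a b c s t x : term V.

(** The new point sits over a point of the algebra: for [k <= n] it sees the same successors, and
    through [<n+1>] it sees that point as well. *)
Definition new_dia (k : nat) a : term V :=
  if k <=? n then tdia k a
  else if k =? S n then tjoin a (tdia k a)
  else tbot.

(** The recursion stops at [tdia], because the new point sees only old points, where [a] keeps its
    old value. Freeness allows any value at the generators; [tbot] is a default. *)
Fixpoint new_val t : term V :=
  match t with
  | tvar _ => tbot
  | tbot => tbot
  | ttop => ttop
  | tneg a => tneg (new_val a)
  | tjoin a b => tjoin (new_val a) (new_val b)
  | tmeet a b => tmeet (new_val a) (new_val b)
  | tdia k a => new_dia k a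
  end.

Lemma new_dia_cases (P : nat -> (term V -> term V) -> Prop) k :
  (k <= n -> P k (tdia k)) ->
  P (S n) (fun a => tjoin a (tdia (S n) a)) ->
  (S n < k -> P k (fun _ => tbot)) ->
  P k (new_dia k).
Proof.
  intros Hle Heq Hgt. unfold new_dia.
  destruct (Nat.leb_spec k n) as [H|H]; [exact (Hle H)|].
  destruct (Nat.eqb_spec k (S n)) as [->|H']; [exact Heq|apply Hgt; lia].
Qed.

Lemma new_dia_cong k a b : teq a b -> teq (new_dia k a) (new_dia k b).
Proof.
  intros H. unfold new_dia.
  destruct (k <=? n); [now rewrite H|].
  destruct (k =? S n); [now rewrite H|reflexivity].
Qed.

Lemma new_dia_join k a b :
  teq (new_dia k (tjoin a b)) (tjoin (new_dia k a) (new_dia k b)).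
Proof.
  apply new_dia_cases with (P := fun k D => teq (D (tjoin a b)) (tjoin (D a) (D b))).
  - intros _. apply glp_i.
  - rewrite glp_i. rewrite !ba_join_assoc.
    rewrite <- (ba_join_assoc a b), (ba_join_comm b (tdia _ a)), (ba_join_assoc a _ b).
    reflexivity.
  - intros _. now rewrite ba_join_bot.
Qed.

Lemma new_dia_bot k : teq (new_dia k tbot) tbot.
Proof.
  apply new_dia_cases with (P := fun k D => teq (D tbot) tbot).
  - intros _. apply glp_ii.
  - now rewrite glp_ii, ba_join_bot.
  - reflexivity.
Qed.

(** For [k = S n], (iii) in the algebra turns the second disjunct on the right into [<k>a], which
    absorbs the part of [a] below [<k>a]. *)
Lemma new_dia_loeb k a :
  teq (new_dia k a) (new_dia k (tmeet a (tneg (tdia k a)))).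
Proof.
  apply new_dia_cases with
    (P := fun k D => teq (D a) (D (tmeet a (tneg (tdia k a))))).
  - intros _. apply glp_iii.
  - rewrite <- glp_iii. apply fle_antisym.
    + apply join_fle; [|apply fle_join_r].
      apply fle_cases with (tdia (S n) a); [|apply fle_join_l].
      eapply fle_trans; [apply meet_fle_r|apply fle_join_r].
    + apply join_fle; [|apply fle_join_r].
      eapply fle_trans; [apply meet_fle_l|apply fle_join_l].
  - reflexivity.
Qed.

Lemma new_dia_le m k a : m <= k ->
  fle (tmeet (refl n a) (new_dia k a)) (new_dia m a).
Proof.
  revert m.
  apply new_dia_cases with
    (P := fun k D => forall m, m <= k -> fle (tmeet (refl n a) (D a)) (new_dia m a)).
  - intros Hk m Hm. unfold new_dia.
    replace (m <=? n) with true by (symmetry; apply Nat.leb_le; lia).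
    eapply fle_trans; [apply meet_fle_r|]. now apply glp_iv.
  - intros m Hm. unfold new_dia.
    destruct (Nat.leb_spec m n) as [H|H].
    + rewrite ba_distr. apply join_fle.
      (* The underlying point satisfies [a] but is no [<m>]-successor of the new point; reflection
         supplies another witness. *)
      * eapply fle_trans; [apply refl_elim|]. now apply glp_iv.
      * eapply fle_trans; [apply meet_fle_r|]. now apply glp_iv.
    + replace m with (S n) by lia. rewrite Nat.eqb_refl. apply meet_fle_r.
  - intros _ m _. eapply fle_trans; [apply meet_fle_r|apply bot_fle].
Qed.

(** For [m = S n] the disjunct [a] would not yield [[k]<m>a]. Since [new_dia] is false above [S n],
    the box there is trivially true. *)
Lemma new_dia_box m k a : m < k ->
  fle (new_dia m a) (tneg (new_dia k (tneg (tdia m a)))).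
Proof.
  revert m.
  apply new_dia_cases with
    (P := fun k D => forall m, m < k -> fle (new_dia m a) (tneg (D (tneg (tdia m a))))).
  - intros Hk m Hm. unfold new_dia.
    replace (m <=? n) with true by (symmetry; apply Nat.leb_le; lia).
    now apply glp_v.
  - intros m Hm. unfold new_dia.
    replace (m <=? n) with true by (symmetry; apply Nat.leb_le; lia).
    apply fle_neg. rewrite ba_distr, ba_compl_meet. apply join_fle; [apply fle_refl|].
    apply fle_contra with (tdia (S n) (tneg (tdia m a))); [apply meet_fle_r|].
    eapply fle_trans; [apply meet_fle_l|]. now apply glp_v.
  - intros _ m _. rewrite neg_bot. apply fle_top.
Qed.

(** * Congruence modulo the reflection filter *)

Definition eq_below c s t : Prop := teq (tmeet c s) (tmeet c t).

Lemma eq_below_mono c d s t : fle c d -> eq_below d s t -> eq_below c s t.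
Proof.
  unfold fle, eq_below. intros Hc H.
  now rewrite <- Hc, <- !ba_meet_assoc, H.
Qed.

Lemma eq_below_neg c s t : eq_below c s t -> eq_below c (tneg s) (tneg t).
Proof.
  (* Contraposition relative to [c], used once in each direction. *)
  enough (main : forall s t, fle (tmeet c t) s -> fle (tmeet c (tneg s)) (tneg t)).
  { unfold eq_below. intros H. apply fle_antisym; (apply fle_meet; [apply meet_fle_l|]); apply main.
    - rewrite <- H. apply meet_fle_r.
    - rewrite H. apply meet_fle_r. }
  clear s t. intros s t H. apply fle_neg, fle_contra with s.
  - eapply fle_trans; [|exact H]. apply meet_mono; [apply meet_fle_l|apply fle_refl].
  - eapply fle_trans; [apply meet_fle_l|apply meet_fle_r].
Qed.

Lemma eq_below_join c s s' t t' :
  eq_below c s s' -> eq_below c t t' -> eq_below c (tjoin s t) (tjoin s' t').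
Proof. unfold eq_below. intros Hs Ht. now rewrite !ba_distr, Hs, Ht. Qed.

Lemma eq_below_meet c s s' t t' :
  eq_below c s s' -> eq_below c t t' -> eq_below c (tmeet s t) (tmeet s' t').
Proof.
  unfold eq_below. intros Hs Ht.
  now rewrite !ba_meet_assoc, Hs, (ba_meet_comm c s'), <- !ba_meet_assoc, Ht.
Qed.

Definition eq_mod_refls s t : Prop := exists l, eq_below (refls n l) s t.

Lemma eq_mod_refls_common s s' t t' :
  eq_mod_refls s s' -> eq_mod_refls t t' ->
  exists l, eq_below (refls n l) s s' /\ eq_below (refls n l) t t'.
Proof.
  intros [l H] [l' H']. exists (l ++ l'). split.
  - eapply eq_below_mono; [apply refls_app_l|exact H].
  - eapply eq_below_mono; [apply refls_app_r|exact H'].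
Qed.

Lemma teq_eq_mod_refls s t : teq s t -> eq_mod_refls s t.
Proof. intros H. exists []. unfold eq_below. now rewrite H. Qed.

(** Induction on the derivation. Boolean axioms transfer because [new_val] commutes with the boolean
    operations; congruence under [tdia] uses the derivation [teq x x'] itself, not its induction
    hypothesis. *)
Lemma new_val_sound s t : teq s t -> eq_mod_refls (new_val s) (new_val t).
Proof.
  induction 1 as
    [ | x y _ [l IH] | x y z _ IHxy _ IHyz | x x' _ [l IH]
    | x x' y y' _ IHx _ IHy | x x' y y' _ IHx _ IHy
    | | | | | | | | | | | | | | | | m k x Hmk | ];
    cbn [new_val tbox]; try (apply teq_eq_mod_refls; solve [eauto using teq]).
  - exists l. now apply teq_sym.
  - destruct (eq_mod_refls_common IHxy IHyz) as (l & Hxy & Hyz).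
    exists l. eapply teq_trans; eassumption.
  - exists l. now apply eq_below_neg.
  - destruct (eq_mod_refls_common IHx IHy) as (l & Hx & Hy).
    exists l. now apply eq_below_join.
  - destruct (eq_mod_refls_common IHx IHy) as (l & Hx & Hy).
    exists l. now apply eq_below_meet.
  - now apply teq_eq_mod_refls, new_dia_cong.
  - apply teq_eq_mod_refls, new_dia_join.
  - apply teq_eq_mod_refls, new_dia_bot.
  - apply teq_eq_mod_refls, new_dia_loeb.
  (* Axiom (iv) is the only rule that adds a reflection term to the list. *)
  - exists [x]. cbn [refls]. unfold eq_below. rewrite ba_meet_top, ba_meet_assoc.
    apply fle_antisym.
    + apply meet_fle_l.
    + apply fle_meet; [apply fle_refl|now apply new_dia_le].
  - now apply teq_eq_mod_refls, new_dia_box.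
Qed.

End NewPoint.

(** At the new point the hypothesis says that [x] joined with [<n+1>x] is below [<n>z], modulo
    finitely many reflection terms; the disjunct [x] is kept. *)
Lemma fle_dia_refls (V : Type) (n : nat) (x z : term V) :
  fle (tdia (S n) x) (tdia n z) ->
  exists l, fle (tmeet x (refls n l)) (tdia n z).
Proof.
  intros H. destruct (new_val_sound n H) as [l Hl]. exists l.
  cbn [new_val] in Hl. unfold eq_below, new_dia in Hl.
  rewrite Nat.leb_refl, Nat.eqb_refl in Hl.
  replace (S n <=? n) with false in Hl by (symmetry; apply Nat.leb_gt; lia).
  rewrite ba_meet_comm.
  apply fle_trans with (tmeet (refls n l) (tjoin x (tdia (S n) x))).
  - apply meet_mono; [apply fle_refl|apply fle_join_l].
  - rewrite <- Hl. eapply fle_trans; apply meet_fle_r.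
Qed.

Theorem theorem3 (V : Type) (n : nat) (x z : term V) :
  fle (tdia (S n) x) (tdia n z) ->
  exists k : nat, fle (Q n k x) (tdia n z).
Proof.
  (* [length l] steps pay for the reflection terms, and one more leaves an [<n>] in front of [x] and
     these terms; then [<n><n>z] collapses to [<n>z]. *)
  intros H. destruct (fle_dia_refls H) as [l Hl]. exists (length l + 1).
  eapply fle_trans; [apply Q_add_refls|]. cbn [Q]. rewrite ba_meet_top.
  eapply fle_trans; [apply dia_mono, Hl|apply dia_trans].
Qed.
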